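(* Let $G$ be a partially ordered group with identity $e$ and positive cone $G^+ = \{x \in G : x > e\}$. Let $\mathcal{J}$ be a set of nonempty finite subsets of $G^+$, and for $A \subseteq G$ let $\sigma_{\mathcal{J}}(A) = \inf\{ |A\cap J|/|J| : J \in \mathcal{J}\}$. Let $A$ and $B$ be subsets of $G^+$ with $\sigma_{\mathcal{J}}(A) + \sigma_{\mathcal{J}}(B) > 1$. If $x \in G^+$ and the open interval $(e,x) = \{y \in G : e < y < x\}$ belongs to $\mathcal{J}$, then there exist $a \in A$ and $b \in B$ with $ab = x$.
   Context: A partially ordered group is a group $G$ with a partial order $\le$ such that $a \le b$ implies $ac \le bc$ and $ca \le cb$ for all $a,b,c \in G$. We write $x<y$ if $x \le y$ and $x \ne y$. *)

(* Defs.v *)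
From HB Require Import structures.
From mathcomp Require Import all_boot all_order all_algebra.
From mathcomp Require Import finmap.
From mathcomp Require Import all_classical reals.

Set Implicit Arguments.
Unset Strict Implicit.
Unset Printing Implicit Defensive.

Local Open Scope classical_set_scope.

(* A [groupType] is not necessarily finite. *)
HB.mixin Record Group_POrder_isPOGroup (d : Order.disp_t) G
    of Group G & Order.POrder d G := {
  po_mulgr : forall a b c : G, (a <= b)%O -> (a * c <= b * c)%O%g;
  po_mulgl : forall a b c : G, (a <= b)%O -> (c * a <= c * b)%O%g
}.

#[short(type="poGroupType")]
HB.structure Definition POGroup (d : Order.disp_t) :=
  { G of Group_POrder_isPOGroup d G & Group G & Order.POrder d G }.

Definition positive_cone (d : Order.disp_t) (G : poGroupType d) : set G :=
  [set x : G | (1%g < x)%O].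

Arguments positive_cone {d} G _.

Definition open_interval (d : Order.disp_t) (G : poGroupType d) (a b : G) :
    set G :=
  [set y : G | (a < y)%O /\ (y < b)%O].

(* [#|` fset_set X|] is the cardinality of [X] only when [X] is finite, and
   [inf] is meaningful only on a nonempty set: the definition is intended for
   a nonempty family [JJ] of nonempty finite sets. *)
Definition sigma (R : realType) (d : Order.disp_t) (G : poGroupType d)
    (JJ : set (set G)) (A : set G) : R :=
  inf [set (#|` fset_set (A `&` J)|%:R / #|` fset_set J|%:R)%R | J in JJ].

(* Main.v *)
Require Import Defs.
From HB Require Import structures.
From mathcomp Require Import all_boot all_order all_algebra.
From mathcomp Require Import finmap.
From mathcomp Require Import all_classical reals.

(** For [J] the interval [(e, x)], the map [b |-> x * b^-1] is an injection of
    [J] into itself.  The hypothesis on [sigma] gives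
    [|A n J| + |B n J| > |J|], so by pigeonhole [A n J] meets the image of
    [B n J]: there are [a] in [A] and [b] in [B] with [a = x * b^-1]. *)

Set Implicit Arguments.
Unset Strict Implicit.
Unset Printing Implicit Defensive.

Import Order.TTheory GRing.Theory Num.Theory.

Local Open Scope classical_set_scope.

(** Strictness survives because translation by [c] is injective; the order axioms only give [<=]. *)
Lemma po_ltgr (d : Order.disp_t) (G : poGroupType d) (a b c : G) :
  (a < b)%O -> (a * c < b * c)%O%g.
Proof.
by rewrite !lt_def (inj_eq (@mulIg _ _)) => /andP[-> /po_mulgr ->].
Qed.

Lemma po_ltgl (d : Order.disp_t) (G : poGroupType d) (a b c : G) :
  (a < b)%O -> (c * a < c * b)%O%g.
Proof.
by rewrite !lt_def (inj_eq (@mulgI _ _)) => /andP[-> /po_mulgl ->].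
Qed.

(** Multiplying [y < x] on the right by [y^-1] gives the lower bound; multiplying [1 < y] on the
    left by [x * y^-1] gives the upper one. *)
Lemma open_interval_divg (d : Order.disp_t) (G : poGroupType d) (x y : G) :
  open_interval 1%g x y -> open_interval 1%g x (x * y^-1)%g.
Proof.
move=> [y_gt1 y_ltx]; split; first by rewrite -(mulgV y); exact: po_ltgr.
by have /(po_ltgl (x * y^-1)%g) := y_gt1; rewrite mulg1 mulgVK.
Qed.

Lemma sigma_le (R : realType) (d : Order.disp_t) (G : poGroupType d)
    (JJ : set (set G)) (A J : set G) : JJ J ->
  (sigma R JJ A <= #|` fset_set (A `&` J)|%:R / #|` fset_set J|%:R)%R.
Proof.
move=> JJJ; apply: ge_inf; last by exists J.
(* All the ratios are nonnegative, so 0 bounds the set below and its infimum is at most each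
   member. *)
by exists 0%R => _ [K _ <-]; rewrite divr_ge0.
Qed.

(** By inclusion-exclusion [|X| + |Y|] is [|X U Y| + |X n Y|], and the union has at most [|F|]
    elements. *)
Lemma fset_pigeonhole (T : choiceType) (F X Y : {fset T}) :
  (X `<=` F)%fset -> (Y `<=` F)%fset -> (#|` F| < #|` X| + #|` Y|)%N ->
  exists2 z, z \in X & z \in Y.
Proof.
move=> XF YF; rewrite -cardfsUI => ltF.
have : (0 < #|` (X `&` Y)%fset|)%N.
  have /fsubset_leq_card leF : (X `|` Y `<=` F)%fset by rewrite fsubUset XF.
  by rewrite -(ltn_add2l #|` F|) addn0 (leq_trans ltF)// leq_add2r.
by rewrite cardfs_gt0 => /fset0Pn[z]; rewrite inE => /andP[]; exists z.
Qed.

Theorem theorem2p2 (R : realType) (d : Order.disp_t) (G : poGroupType d)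
    (JJ : set (set G))
    (hJJ : forall J : set G, JJ J ->
       [/\ J !=set0, finite_set J & J `<=` positive_cone G])
    (A B : set G)
    (hA : A `<=` positive_cone G) (hB : B `<=` positive_cone G)
    (hAB : (1 < sigma R JJ A + sigma R JJ B)%R)
    (x : G) (hx : positive_cone G x) (hxJ : JJ (open_interval 1%g x)) :
  exists a b : G, [/\ A a, B b & (a * b)%g = x].
Proof.
set J := open_interval 1%g x in hxJ.
have [[y Jy] finJ _] := hJJ _ hxJ.
have finI (C : set G) : finite_set (C `&` J) by exact: finite_setIr.
have J_gt0 : (0 < #|` fset_set J|)%N.
  by rewrite cardfs_gt0; apply/fset0Pn; exists y; rewrite in_fset_set// inE.
have ltJ : (#|` fset_set J| <
            #|` fset_set (A `&` J)| + #|` fset_set (B `&` J)|)%N.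
  (* Both infima are bounded by their ratios at the same member [J]; the common denominator is
     positive by [J_gt0] and can be cleared. *)
  have := lt_le_trans hAB (lerD (sigma_le R A hxJ) (sigma_le R B hxJ)).
  by rewrite -mulrDl ltr_pdivlMr ?ltr0n// mul1r -natrD ltr_nat.
pose f (b : G) := (x * b^-1)%g.
have f_inj : injective f by move=> b c /mulgI /invg_inj.
have finf : finite_set (f @` (B `&` J)) by exact: finite_image.
have cardf : #|` fset_set (f @` (B `&` J))| = #|` fset_set (B `&` J)|.
  by rewrite fset_set_image// card_imfset.
have [|||z] :=
  @fset_pigeonhole _ (fset_set J) (fset_set (A `&` J))
    (fset_set (f @` (B `&` J))).
- by rewrite -fset_set_sub// => z [].
- by rewrite -fset_set_sub// => _ [b [_ Jb] <-]; exact: open_interval_divg.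
- by rewrite cardf.
(* The common element [z] lies in [A] and equals [x * b^-1] with [b] in [B], so [z * b = x]. *)
rewrite !in_fset_set// !inE => -[Az _] [b [Bb _] zE].
by exists z, b; split => //; rewrite -zE /f mulgVK.
Qed.
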